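(* Let $1\le d<n$, and let $\theta$ be a complex skew-symmetric $n\times n$ matrix which is block diagonal with respect to $n=d+(n-d)$. The noncommutative product $\times_\theta$ in the algebra of left coinvariants ${}^{\mathrm{co}\text{-}\mathcal L^\theta_{d,n}}\mathcal F_n^\theta$ is described by commutation relations among the generators $\eta_{ij}$ and $\eta^\perp_{ij}$ given, for all $i,j,i',j'\in\{1,\dots,n\}$, by $$\eta_{ij}\times_\theta\eta_{i'j'}=K^2_{ij;i'j'}\ \eta_{i'j'}\times_\theta\eta_{ij},$$ $$\eta^\perp_{ij}\times_\theta\eta^\perp_{i'j'}=K^2_{ij;i'j'}\ \eta^\perp_{i'j'}\times_\theta\eta^\perp_{ij},$$ $$\eta_{ij}\times_\theta\eta^\perp_{i'j'}=K^2_{ij;i'j'}\ \eta^\perp_{i'j'}\times_\theta\eta_{ij},$$ where $K_{ij;i'j'}=q_{ii'}\,q_{j'i}\,q_{i'j}\,q_{jj'}$ and $q_{ij}=\exp(\tfrac{\mathrm i}{2}\theta^{ij})$.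
   Context: $\mathcal F_n=\mathrm{Fun}(\mathrm{GL}(n))$ is the commutative Hopf algebra over $\mathbb C$ of (polynomial) functions on $\mathrm{GL}(n)$, generated by matrix elements $g_{ij}$ (with the determinant inverted), with $\Delta_\vee(g_{ij})=\sum_kg_{ik}\otimes g_{kj}$, $\varepsilon_\vee(g_{ij})=\delta_{ij}$, and antipode $S_\vee(g_{ij})(P)=g_{ij}(P^{-1})$. The matrix $\theta$ consists of skew-symmetric blocks $\theta_{(d)}$ (for $1\le i,j\le d$) and $\theta_{(n-d)}$ (for $d+1\le i,j\le n$), with all other entries zero. The Hopf algebra $\mathcal F_n^\theta$ has the same underlying vector space, coproduct, counit and antipode as $\mathcal F_n$, with the product $$a\times_\theta b=F^\theta(a_{(1)}\otimes b_{(1)})\,(a_{(2)}\cdot b_{(2)})\,(F^\theta)^{-1}(a_{(3)}\otimes b_{(3)}),$$ where $\cdot$ is the product of $\mathcal F_n$, $F^\theta(a\otimes b)=\langle F_\theta,a\otimes b\rangle$ and $(F^{\theta})^{-1}(a\otimes b)=\langle F_\theta^{-1},a\otimes b\rangle$ with $F_\theta=\exp(-\tfrac{\mathrm i}{2}\sum_{a,b}\theta^{ab}H_a\otimes H_b)$. Here $H_a=E_{aa}$ are the diagonal generators of $\mathfrak{gl}(n)$, and the pairing is the Hopf pairing of the enveloping algebra of $\mathfrak{gl}(n)$ with $\mathcal F_n$, $\langle H_k,g_{ij}\rangle=\delta_{ik}\delta_{jk}$. On generators, $g_{ij}\times_\theta g_{kl}=q_{ki}\,q_{jl}\,(g_{ij}\cdot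 g_{kl})$. $\mathcal L_{d,n}=\mathrm{Fun}(\mathrm{GL}(d)\times\mathrm{GL}(n-d))$ has generators $l_{ij}$ with $1\le i,j\le d$ or $d+1\le i,j\le n$; the projection $\pi:\mathcal F_n\to\mathcal L_{d,n}$ sends $g_{ij}$ to $l_{ij}$ for those indices and to $0$ otherwise. $\mathcal L_{d,n}^\theta$ is the analogous deformation of $\mathcal L_{d,n}$ by $\theta_{(d)}$ and $\theta_{(n-d)}$. The left coaction of $\mathcal L_{d,n}^\theta$ on $\mathcal F_n^\theta$ is ${}^{\mathcal L_{d,n}}\Phi=(\pi\otimes1)\Delta_\vee$ (unchanged by the deformation), and ${}^{\mathrm{co}\text{-}\mathcal L^\theta_{d,n}}\mathcal F_n^\theta=\{g\in\mathcal F_n^\theta:{}^{\mathcal L_{d,n}}\Phi(g)=1\otimes g\}$. It is generated by the elements $$\eta_{ij}=\sum_{k=1}^dS_\vee(g_{ik})\,g_{kj},\qquad\eta^\perp_{ij}=\sum_{k=d+1}^nS_\vee(g_{ik})\,g_{kj}\qquad(1\le i,j\le n),$$ where the products in these definitions are those of the undeformed algebra $\mathcal F_n$. *)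

(* Defs.v *)
From HB Require Import structures.
From mathcomp Require Import all_boot all_order all_algebra.
From mathcomp Require Import complex.
From mathcomp Require Import all_classical all_reals all_analysis.

Set Implicit Arguments.
Unset Strict Implicit.
Unset Printing Implicit Defensive.

Import Order.TTheory GRing.Theory Num.Theory.
Import numFieldNormedType.Exports.

Local Open Scope classical_set_scope.
Local Open Scope ring_scope.

(* Declared as a numClosedFieldType, so that the topology of numeric fields
   applies to it. *)
Definition Cplx (R : realType) : numClosedFieldType := R[i].

(* The exponential series; sequences.v has it over a realType only. *)
Definition cexp (R : realType) (z : Cplx R) : Cplx R :=
  limn (series (fun m => z ^+ m / m`!%:R)).

Section GeneralLinearGroup.
Variables (R : realType) (n : nat).
Local Notation C := (Cplx R).

Record GL := MkGL { GLval :> 'M[C]_n; GLvalP : GLval \in unitmx }.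

HB.instance Definition _ := [isSub for GLval].
HB.instance Definition _ := [Choice of GL by <:].

Definition GL_one : GL := MkGL (unitmx1 C n).

Fact GL_mul_subproof (P Q : GL) : P *m Q \in unitmx.
Proof. by rewrite unitmx_mul !GLvalP. Qed.
Definition GL_mul (P Q : GL) : GL := MkGL (GL_mul_subproof P Q).

Fact GL_inv_subproof (P : GL) : invmx P \in unitmx.
Proof. by rewrite unitmx_inv GLvalP. Qed.
Definition GL_inv (P : GL) : GL := MkGL (GL_inv_subproof P).

Fact GL_mulA : associative GL_mul.
Proof. by move=> P Q S; apply: val_inj; rewrite /= mulmxA. Qed.
Fact GL_mul1 : left_id GL_one GL_mul.
Proof. by move=> P; apply: val_inj; rewrite /= mul1mx. Qed.
Fact GL_mulr1 : right_id GL_one GL_mul.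
Proof. by move=> P; apply: val_inj; rewrite /= mulmx1. Qed.
Fact GL_mulV : left_inverse GL_one GL_inv GL_mul.
Proof. by move=> P; apply: val_inj; rewrite /= mulVmx // GLvalP. Qed.
Fact GL_mulrV : right_inverse GL_one GL_inv GL_mul.
Proof. by move=> P; apply: val_inj; rewrite /= mulmxV // GLvalP. Qed.

HB.instance Definition _ :=
  isGroup.Build GL GL_mulA GL_mul1 GL_mulr1 GL_mulV GL_mulrV.

End GeneralLinearGroup.

Section HopfAlgebra.
Variables (R : realType) (n : nat).
Local Notation C := (Cplx R).
Local Notation G := (GL R n).

Definition g (i j : 'I_n) : G -> C := fun P => (P : 'M[C]_n) i j.

(* Fun(GL(n)) inside the commutative C-algebra of all functions GL(n) -> C:
   the subalgebra generated by the g_ij and det^-1. *)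
Inductive Fn : (G -> C) -> Prop :=
| Fn_cst c : Fn (cst c)
| Fn_g i j : Fn (g i j)
| Fn_detV : Fn (fun P => (\det (P : 'M[C]_n))^-1)
| Fn_add a b : Fn a -> Fn b -> Fn (a + b)
| Fn_mul a b : Fn a -> Fn b -> Fn (a * b).

(* The tensor powers of Fun(GL(n)) are identified with functions of several
   (curried) variables, a (x) b being P, Q |-> a P * b Q.  Thus
   a_(1) (x) a_(2) (x) a_(3) is the function P, Q, S |-> a (P Q S), and a
   functional is applied to one tensor factor by slicing. *)
Definition coproduct (a : G -> C) : G -> G -> C := fun P Q => a (P * Q)%g.
Definition counit (a : G -> C) : C := a 1%g.
Definition antipode (a : G -> C) : G -> C := fun P => a (P^-1)%g.

Lemma coproduct_g i j P Q :
  coproduct (g i j) P Q = \sum_(k < n) g i k P * g k j Q.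
Proof. by rewrite /coproduct /g /= mxE. Qed.

Lemma counit_g i j : counit (g i j) = (i == j)%:R.
Proof. by rewrite /counit /g /= mxE. Qed.

(* The Hopf pairing of X in gl(n) with a: the derivative of a along X at the
   identity.  The default value 1 is only used for 1 + t X not invertible,
   which does not happen for t near 0. *)
Definition pairing (X : 'M[C]_n) (a : G -> C) : C :=
  derive1 (fun t : C => a (insubd (1%g : G) (1%:M + t *: X))) 0.

Section PairingTheory.
Implicit Types (X : 'M[C]_n) (a b : G -> C).

Lemma derivable_det_line X :
  derivable (fun t : C => \det (1%:M + t *: X)) 0 1.
Proof.
pose p : {poly C} := \det (1%:M + 'X *: map_mx polyC X).
have -> : (fun t : C => \det (1%:M + t *: X)) = (fun t => p.[t]).
  apply/funext => t; rewrite /p -horner_evalE -det_map_mx; congr (\det _).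
  apply/matrixP => i j; rewrite !mxE /= horner_evalE hornerD hornerM hornerX.
  by rewrite hornerC; case: (i == j); rewrite ?hornerC ?horner0.
elim/poly_ind: p => [|p c ih].
  have -> : (fun t : C => (0 : {poly C}).[t]) = cst 0.
    by apply/funext => t; rewrite horner0.
  exact: derivable_cst.
have -> : (fun t : C => (p * 'X + c%:P).[t]) = (fun t => p.[t]) * id + cst c.
  by apply/funext => t; rewrite hornerMXaddC.
apply: derivableD; last exact: derivable_cst.
apply: derivableM; [exact: ih|exact: derivable_id].
Qed.

Lemma near_unit_line X :
  \forall t \near (0 : C), 1%:M + t *: X \in unitmx.
Proof.
have c : {for (0 : C), continuous (fun t : C => \det (1%:M + t *: X))}.
  apply: differentiable_continuous; apply/derivable1_diffP.
  exact: (@derivable_det_line X).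
have : \det (1%:M + (0 : C) *: X) != 0 by rewrite scale0r addr0 det1 oner_eq0.
move=> d0.
near=> t; rewrite unitmxE unitfE; near: t; exact: (cvgr_neq0 _ c d0).
Unshelve. all: end_near.
Qed.

Fact line0 X : insubd (1%g : G) (1%:M + 0 *: X) = 1%g.
Proof. by apply: val_inj; rewrite scale0r addr0 val_insubd unitmx1. Qed.

Lemma derivable_Fn X a : Fn a ->
  derivable (fun t : C => a (insubd (1%g : G) (1%:M + t *: X))) 0 1.
Proof.
elim=> {a} [c|i j||a b _ da _ db|a b _ da _ db]; first exact: derivable_cst.
- have /(near_eq_derivable _) :
      derivable (fun t : C => (1%:M : 'M[C]_n) i j + t * X i j) 0 1.
    apply: derivableD; first exact: derivable_cst.
    by apply: derivableM; [exact: derivable_id|exact: derivable_cst].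
  apply; near=> t; rewrite /g val_insubd (near (near_unit_line X) t) //.
  by rewrite !mxE.
- have : derivable (fun t : C => (\det (1%:M + t *: X))^-1) 0 1.
    apply: derivableV; last exact: derivable_det_line.
    by rewrite scale0r addr0 det1 oner_neq0.
  move/(near_eq_derivable _); apply; near=> t.
  by rewrite val_insubd (near (near_unit_line X) t).
- exact: derivableD da db.
- exact: derivableM da db.
Unshelve. all: end_near.
Qed.

(* On Fn, pairing X is thus the linear functional with
   <X, a b> = <X, a> counit(b) + counit(a) <X, b> and <X, g_ij> = X i j, which
   determine it; in particular <H_k, g_ij> = (i == k) (j == k). *)
Lemma pairing_cst X c : pairing X (cst c) = 0.
Proof. exact: derive1_cst. Qed.

Lemma pairing_g X i j : pairing X (g i j) = X i j.
Proof.
rewrite /pairing derive1E.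
transitivity ('D_1 (fun t : C => (1%:M : 'M[C]_n) i j + t * X i j) 0).
  apply: near_eq_derive; near=> t.
  rewrite /g val_insubd (near (near_unit_line X) t) //.
  by rewrite !mxE.
rewrite deriveD; [|exact: derivable_cst|
  by apply: derivableM; [exact: derivable_id|exact: derivable_cst]].
rewrite derive_cst add0r deriveM; [|exact: derivable_id|exact: derivable_cst].
by rewrite derive_cst derive_id scaler0 add0r; exact: mulr1.
Unshelve. all: end_near.
Qed.

Lemma pairingD X a b : Fn a -> Fn b ->
  pairing X (a + b) = pairing X a + pairing X b.
Proof.
move=> /(derivable_Fn (X:=X)) da /(derivable_Fn (X:=X)) db.
rewrite /pairing !derive1E; exact: (deriveD da db).
Qed.

Lemma pairingM X a b : Fn a -> Fn b ->
  pairing X (a * b) = pairing X a * counit b + counit a * pairing X b.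
Proof.
move=> /(derivable_Fn (X:=X)) da /(derivable_Fn (X:=X)) db.
have := deriveM da db; rewrite line0.
rewrite /pairing /counit !derive1E => e; rewrite [LHS]e.
rewrite addrC; congr (_ + _); exact: mulrC.
Qed.

End PairingTheory.

Definition Hdiag (k : 'I_n) : (G -> C) -> C := pairing (delta_mx k k).

(* Functionals on the tensor square of Fun(GL(n)). *)
Definition functional2 := (G -> G -> C) -> C.

Definition tens (phi psi : (G -> C) -> C) : functional2 :=
  fun f => phi (fun P => psi (fun P' => f P P')).

(* In a Hopf pairing the product of the enveloping algebra is dual to the
   coproduct, so it acts on functions by convolution. *)
Definition conv2 (Phi Psi : functional2) : functional2 :=
  fun f => Phi (fun P P' => Psi (fun Q Q' => f (P * Q)%g (P' * Q')%g)).

Definition counit2 : functional2 := fun f => f 1%g 1%g.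

(* exp(Z) = \sum_m Z^m / m!, paired termwise; on the tensor square of
   Fun(GL(n)) the series converges for Z in the span of the H_a (x) H_b. *)
Definition exp2 (Z : functional2) : functional2 :=
  fun f => limn (series (fun m => iter m (conv2 Z) counit2 f / m`!%:R)).

Section Twist.
Variable theta : 'M[C]_n.

(* -(i/2) \sum_(a,b) theta^{ab} H_a (x) H_b *)
Definition twist_exponent : functional2 :=
  fun f => - ('i / 2) *
    \sum_(a < n) \sum_(b < n) theta a b * tens (Hdiag a) (Hdiag b) f.

Definition F_theta : functional2 := exp2 twist_exponent.
Definition F_theta_inv : functional2 := exp2 (fun f => - twist_exponent f).

(* F_theta(a_(1) (x) b_(1)) (a_(2) b_(2)) F_theta^-1(a_(3) (x) b_(3)) *)
Definition times_theta (a b : G -> C) : G -> C := fun Q =>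
  F_theta (fun P P' =>
    F_theta_inv (fun S S' => a (P * Q * S)%g * b (P' * Q * S')%g)).

Definition q_theta (i j : 'I_n) : C := cexp ('i / 2 * theta i j).

Definition K_theta (i j i' j' : 'I_n) : C :=
  q_theta i i' * q_theta j' i * q_theta i' j * q_theta j j'.

End Twist.

Section Levi.
Variable d : nat.

(* Ordinals are 0-based: the index i of the first block has i < d. *)
Definition same_block (i j : 'I_n) : bool := (i < d)%N == (j < d)%N.

(* GL(d) x GL(n-d) as the block diagonal matrices of GL(n). *)
Record Levi := MkLevi {
  Levi_val :> G;
  LeviP : forall i j, ~~ same_block i j -> (Levi_val : 'M[C]_n) i j = 0 }.

(* Restriction of functions: g_ij |-> l_ij if same_block i j, and 0 if not. *)
Definition Levi_proj (a : G -> C) : Levi -> C := fun h => a h.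

(* (pi (x) 1) o Delta; the twist changes neither map. *)
Definition Levi_coaction (a : G -> C) : Levi -> G -> C :=
  fun h P => Levi_proj (fun Q => coproduct a Q P) h.

Definition coinvariant (a : G -> C) : Prop :=
  Fn a /\ forall h P, Levi_coaction a h P = a P.

Definition eta (i j : 'I_n) : G -> C :=
  \sum_(k < n | (k < d)%N) antipode (g i k) * g k j.

Definition eta_perp (i j : 'I_n) : G -> C :=
  \sum_(k < n | (d <= k)%N) antipode (g i k) * g k j.

End Levi.

End HopfAlgebra.

(* Main.v *)
Require Import Defs.
From mathcomp Require Import all_boot all_order all_algebra.
From mathcomp Require Import perm complex.
From mathcomp Require Import all_classical all_reals all_analysis.
From mathcomp Require Import ring.

Set Implicit Arguments.
Unset Strict Implicit.
Unset Printing Implicit Defensive.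

Import Order.TTheory GRing.Theory Num.Theory.
Import numFieldNormedType.Exports.
Local Open Scope ring_scope.

(** Both families of generators are entries of conjugated diagonal idempotents:
    eta_ij(P) = (P^-1 E P)_ij with E the projection on the first d coordinates,
    and eta_perp is the same with 1 - E.  For a diagonal matrix M, the function
    a(P) = (P^-1 M P)_ij has two features that trivialise the twisted product.

    On the left, M commutes with the diagonal torus, so a(h P) = a(P) for h
    diagonal, and the factor F_theta(a_(1), b_(1)) of the product contributes
    only its constant term.  On the right, a(P h) = h_i^-1 a(P) h_j, so a is a
    weight vector of weight e_j - e_i; since F_theta^-1 is the exponential of
    a form in the H_a, it acts on a pair of weight vectors as the scalar
    exp((i/2) theta(e_j - e_i, e_j' - e_i')).  Hence
      a x_theta b = exp((i/2) theta(e_j - e_i, e_j' - e_i')) a b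
    ([times_theta_conj_diag]), with the commutative pointwise product a b.
    Exchanging the factors changes the sign of the exponent because theta is
    skew, and the scalar itself is K_{ij;i'j'} ([K_thetaE]), so the two orders
    differ by K^2.

    Two ingredients make this precise.  The exponential of functionals is an
    explicit series: the m-fold convolution power of the exponent multiplies
    each product of matrix entries by the m-th power of its eigenvalue
    ([iter_exponent_conj_pair]), which follows from the Leibniz rule for the
    pairing, <X, (P^-1 M P)_kl> = [M, X]_kl.  And the complex exponential series
    must converge and satisfy exp(z + w) = exp(z) exp(w) ([cvg_exp_series],
    [cexpD]); both are reduced to the real exponential by domination.

    Coinvariance is the invariance a(h P) = a(P) again, for h in the Levi
    subgroup, which commutes with E and 1 - E. *)

(** * The complex exponential *)

Definition exp_term (F : numFieldType) (z : F) (m : nat) : F := z ^+ m / m`!%:R.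

Lemma exp_term_add (F : numFieldType) (z w : F) (k : nat) :
  exp_term (z + w) k =
  \sum_(j < k.+1) exp_term z (k - j) * exp_term w j.
Proof.
rewrite /exp_term exprDn mulr_suml; apply: eq_bigr => j _.
have jk : (j <= k)%N by rewrite -ltnS.
rewrite -mulr_natr -(bin_fact jk) !natrM.
have h l : (l`!%:R : F) != 0 by rewrite pnatr_eq0 -lt0n fact_gt0.
have hb : ('C(k, j)%:R : F) != 0 by rewrite pnatr_eq0 -lt0n bin_gt0.
by field; rewrite (h j) (h (k - j)%N) hb.
Qed.

(** The Cauchy product of two truncated series is a square of terms; its
    lower triangle is the truncated series of the sum by the binomial theorem.
    The remaining terms appear explicitly, so that their norms can be summed. *)
Lemma exp_series_mul (F : numFieldType) (z w : F) (m : nat) :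
  series (exp_term z) m * series (exp_term w) m = series (exp_term (z + w)) m +
    \sum_(j < m) \sum_(i < m | ~~ (i + j < m)%N) exp_term z i * exp_term w j.
Proof.
have -> : series (exp_term (z + w)) m =
    \sum_(j < m) \sum_(i < m | (i + j < m)%N) exp_term z i * exp_term w j.
  rewrite /series /= big_mkord.
  transitivity (\sum_(k < m) \sum_(j < m | (j <= k)%N)
                  exp_term z (k - j) * exp_term w j).
    apply: eq_bigr => k _; rewrite exp_term_add.
    exact: (big_ord_widen m (fun j => exp_term z (k - j) * exp_term w j)).
  rewrite (exchange_big_dep xpredT) //=; apply: eq_bigr => j _.
  rewrite -(big_geq_mkord _ _ xpredT (fun k => exp_term z (k - j) * exp_term w j)).
  rewrite -[X in \sum_(X <= _ < _) _]add0n big_addn big_mkord.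
  rewrite (big_ord_widen m (fun i => exp_term z (i + j - j) * exp_term w j)) ?leq_subr //.
  apply: eq_big => [i|i _]; last by rewrite addnK.
  by rewrite ltn_subRL addnC.
rewrite -big_split /series /= !big_mkord mulrC mulr_suml.
apply: eq_bigr => j _; rewrite mulr_sumr.
rewrite (bigID (fun i : 'I_m => (i + j < m)%N)) /=.
by congr (_ + _); apply: eq_bigr => i _; rewrite mulrC.
Qed.

Section ComplexExponential.
Local Open Scope classical_set_scope.
Variable R : realType.
Local Notation C := (Cplx R).

Lemma norm_imaginary_unit : `|'i%C : R[i]| = 1.
Proof. by rewrite normc_def /= expr0n expr1n add0r sqrtr1. Qed.

Lemma norm_real_complex (x : R) : `|x%:C%C : R[i]| = `|x|%:C%C.
Proof. by rewrite normc_def /= expr0n addr0 sqrtr_sqr. Qed.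

Lemma normc_ge_Im (z : R[i]) : `|complex.Im z|%:C%C <= `|z|.
Proof.
have := normc_ge_Re (z * 'i%C).
by rewrite ReiNIm normrN normrM norm_imaginary_unit mulr1.
Qed.

Lemma normc_le_ReIm (z : R[i]) :
  `|z| <= `|complex.Re z|%:C%C + `|complex.Im z|%:C%C.
Proof.
rewrite {1}[z]complexE (le_trans (ler_normD _ _)) // normrM.
by rewrite norm_imaginary_unit mul1r !norm_real_complex.
Qed.

(** Complex numbers are only partially ordered, and being positive includes
    being real: the epsilons of the complex topology are real. *)
Lemma gt0_Cplx (e : C) : 0 < e -> exists2 r : R, 0 < r & e = r%:C%C :> R[i].
Proof.
case: e => r s; rewrite ltcE /= => /andP[/eqP -> r_gt0].
by exists r.
Qed.

Lemma cvg_Cplx (u : nat -> C) (l : C) :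
  (fun k => complex.Re (u k : R[i])) @ \oo --> complex.Re (l : R[i]) ->
  (fun k => complex.Im (u k : R[i])) @ \oo --> complex.Im (l : R[i]) ->
  u @ \oo --> l.
Proof.
move=> hr hi; apply/cvgrPdist_lt => e /gt0_Cplx[r r_gt0 ->].
near=> k.
apply: le_lt_trans (normc_le_ReIm _) _.
rewrite -rmorphD ltcR !raddfB /= [ltRHS](splitr r).
apply: ltrD; near: k.
  by move/cvgrPdist_lt: hr; apply; rewrite divr_gt0.
by move/cvgrPdist_lt: hi; apply; rewrite divr_gt0.
Unshelve. all: end_near. Qed.

Definition modulus (z : C) : R := complex.Re (`|z| : R[i]).

Lemma modulusE (z : C) : `|z| = (modulus z)%:C%C :> R[i].
Proof. by rewrite /modulus; apply/esym/RRe_real/normr_real. Qed.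

Lemma norm_exp_term (z : C) (m : nat) :
  `|exp_term z m| = (exp_term (modulus z) m)%:C%C :> R[i].
Proof.
rewrite /exp_term normrM normfV normrX normr_nat modulusE.
by rewrite rmorphM /= fmorphV rmorphXn rmorph_nat.
Qed.

(** The real and imaginary parts are dominated termwise by the real
    exponential series at the modulus; this route only uses completeness of
    the reals. *)
Lemma cvg_exp_series (z : C) : series (exp_term z) @ \oo --> cexp z.
Proof.
have dom (f : {additive R[i] -> R}) : (forall t, `|f t|%:C%C <= `|t|) ->
    cvgn (fun k => f (series (exp_term z) k)).
  move=> fle; have -> : (fun k => f (series (exp_term z) k)) =
      series (fun m => f (exp_term z m)).
    by apply/funext => k; rewrite /series /= raddf_sum.
  apply: normed_cvg; apply: series_le_cvg (is_cvg_series_exp_coeff (modulus z)).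
  - by move=> m; exact: normr_ge0.
  - move=> m; rewrite -[leRHS]/(exp_term (modulus z) m) -ler0c -norm_exp_term.
    exact: normr_ge0.
  - move=> m; rewrite -lecR -[leRHS]/((exp_term (modulus z) m)%:C%C).
    by rewrite -norm_exp_term; exact: fle.
have cRe := dom (@complex.Re R) (@normc_ge_Re R).
have cIm := dom (@complex.Im R) normc_ge_Im.
pose l : R[i] := (limn (fun k => complex.Re (series (exp_term z) k : R[i])) +i*
  limn (fun k => complex.Im (series (exp_term z) k : R[i])))%C.
suff /cvgP : series (exp_term z) @ \oo --> (l : C) by [].
by apply: cvg_Cplx.
Qed.

(** The off-triangle remainder of the Cauchy product at (z, w) is bounded by
    the one at the moduli, which tends to
    expR `|z| * expR `|w| - expR (`|z| + `|w|) = 0. *)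
Lemma cexpD (z w : C) : cexp (z + w) = cexp z * cexp w.
Proof.
pose rem (F : numFieldType) (a b : F) m :=
  \sum_(j < m) \sum_(i < m | ~~ (i + j < m)%N) exp_term a i * exp_term b j.
have remE (F : numFieldType) (a b : F) m : rem F a b m =
    series (exp_term a) m * series (exp_term b) m - series (exp_term (a + b)) m.
  by rewrite exp_series_mul addrC addKr.
have cvg_rem : rem C z w @ \oo --> cexp z * cexp w - cexp (z + w).
  have -> : rem C z w = (fun m => series (exp_term z) m * series (exp_term w) m
      - series (exp_term (z + w)) m) by apply/funext => m.
  apply: cvgB; last exact: cvg_exp_series.
  apply: cvgM; exact: cvg_exp_series.
have rem0 : rem R (modulus z) (modulus w) @ \oo --> (0 : R).
  have cx (x : R) : series (exp_term x) @ \oo --> expR x.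
    exact: is_cvg_series_exp_coeff.
  have -> : rem R (modulus z) (modulus w) = (fun m =>
      series (exp_term (modulus z)) m * series (exp_term (modulus w)) m
      - series (exp_term (modulus z + modulus w)) m) by apply/funext => m.
  rewrite -(subrr (expR (modulus z + modulus w))) {1}expRD.
  by apply: cvgB; [apply: cvgM|]; exact: cx.
have cvg_rem0 : rem C z w @ \oo --> (0 : C).
  have le_rem m : `|rem C z w m| <= (rem R (modulus z) (modulus w) m)%:C%C :> R[i].
    rewrite /rem rmorph_sum (le_trans (ler_norm_sum _ _ _)) //.
    apply: ler_sum => j _; rewrite rmorph_sum (le_trans (ler_norm_sum _ _ _)) //.
    by apply: ler_sum => i _; rewrite normrM rmorphM /= !norm_exp_term.
  apply/cvgrPdist_lt => e /gt0_Cplx[r r_gt0 ->].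
  near=> m; rewrite sub0r normrN (le_lt_trans (le_rem m)) // ltcR.
  rewrite (le_lt_trans (ler_norm _)) // -normrN -sub0r; near: m.
  by move/cvgrPdist_lt: rem0; apply.
apply/esym/subr0_eq.
exact: cvg_unique cvg_rem cvg_rem0.
Unshelve. all: end_near. Qed.

Lemma cexp0 : cexp (0 : C) = 1.
Proof.
have shift : (fun m => series (exp_term (0 : C)) m.+1) @ \oo --> cexp (0 : C).
  by rewrite (cvg_shiftS (series (exp_term (0 : C)))); exact: cvg_exp_series.
apply: cvg_unique shift _ => //.
have -> : (fun m => series (exp_term (0 : C)) m.+1) = fun=> 1.
  apply/funext => m; rewrite /series /= big_nat_recl // /exp_term expr0 divr1.
  by rewrite big1 ?addr0 // => k _; rewrite expr0n mul0r.
exact: cvg_cst.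
Qed.

End ComplexExponential.

(** * Polynomial functions on GL(n) and their derivatives at the identity *)

Section FunctionsOnGL.
Variables (R : realType) (n : nat).
Local Notation C := (Cplx R).
Local Notation G := (GL R n).
Implicit Types (X M : 'M[C]_n) (P Q : G).

Lemma Fn_sum (I : Type) (r : seq I) (p : pred I) (a : I -> G -> C) :
  (forall i, Fn (a i)) -> Fn (fun P => \sum_(i <- r | p i) a i P).
Proof.
move=> Fa; elim: r => [|i r ih].
  under eq_fun do rewrite big_nil; exact: Fn_cst.
under eq_fun do rewrite big_cons.
by case: (p i) => //; exact: (Fn_add (Fa i) ih).
Qed.

Lemma Fn_prod (I : Type) (r : seq I) (a : I -> G -> C) :
  (forall i, Fn (a i)) -> Fn (fun P => \prod_(i <- r) a i P).
Proof.
move=> Fa; elim: r => [|i r ih].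
  under eq_fun do rewrite big_nil; exact: Fn_cst.
by under eq_fun do rewrite big_cons; exact: (Fn_mul (Fa i) ih).
Qed.

Lemma Fn_scale (c : C) (a : G -> C) : Fn a -> Fn (fun P => c * a P).
Proof. exact: Fn_mul (Fn_cst _ c). Qed.

Lemma antipode_gE (i j : 'I_n) P : antipode (@g R n i j) P = invmx (P : 'M[C]_n) i j.
Proof. by []. Qed.

Lemma Fn_antipode_g (i j : 'I_n) : Fn (antipode (@g R n i j)).
Proof.
have -> : antipode (@g R n i j) = (fun P => (\det (P : 'M[C]_n))^-1) *
    (fun P => (-1) ^+ (j + i) * \sum_(s : 'S_n.-1) (-1) ^+ s *
       \prod_k g (lift j k) (lift i (s k)) P).
  apply/funext => P; rewrite antipode_gE /invmx GLvalP !mxE /cofactor.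
  congr (_ * (_ * _)); apply: eq_bigr => s _; congr (_ * _).
  by apply: eq_bigr => k _; rewrite !mxE.
apply: Fn_mul; first exact: Fn_detV.
apply/Fn_scale/Fn_sum => s; apply/Fn_scale/Fn_prod => k; exact: Fn_g.
Qed.

Lemma pairing_scale X (c : C) (a : G -> C) :
  Fn a -> pairing X (fun P => c * a P) = c * pairing X a.
Proof.
move=> Fa; rewrite (pairingM X (Fn_cst _ c) Fa).
by rewrite pairing_cst mul0r add0r.
Qed.

Lemma pairing_sum X (I : Type) (r : seq I) (a : I -> G -> C) :
  (forall i, Fn (a i)) ->
  pairing X (fun P => \sum_(i <- r) a i P) = \sum_(i <- r) pairing X (a i).
Proof.
move=> Fa; elim: r => [|i r ih].
  under eq_fun do rewrite big_nil; rewrite big_nil; exact: pairing_cst.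
under eq_fun do rewrite big_cons.
by rewrite big_cons -ih; apply: pairingD => //; exact: Fn_sum.
Qed.

Lemma counit_antipode_g (i j : 'I_n) : counit (antipode (@g R n i j)) = (i == j)%:R.
Proof. by rewrite -counit_g /counit /antipode invg1. Qed.

(** Differentiating the identity P^-1 P = 1 determines the derivative of the
    inverse. *)
Lemma pairing_antipode_g X (i j : 'I_n) : pairing X (antipode (g i j)) = - X i j.
Proof.
have : pairing X (fun P => \sum_k (antipode (g i k) * g k j) P) = 0.
  have -> : (fun P => \sum_k (antipode (@g R n i k) * g k j) P) =
      cst (i == j)%:R.
    apply/funext => P; transitivity ((invmx P *m (P : 'M[C]_n)) i j).
      by rewrite mxE; apply: eq_bigr => k _; rewrite -antipode_gE.
    by rewrite mulVmx ?GLvalP // mxE.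
  exact: pairing_cst.
rewrite pairing_sum; last first.
  by move=> k; apply: Fn_mul; [exact: Fn_antipode_g|exact: Fn_g].
under eq_bigr => k _.
  rewrite pairingM ?counit_g ?counit_antipode_g ?pairing_g;
    [over|exact: Fn_antipode_g|exact: Fn_g].
rewrite big_split /= (bigD1 j) //= big1 => [|k /negPf ->]; last by rewrite mulr0.
rewrite (bigD1 i) //= big1 => [|k]; last by rewrite eq_sym => /negPf ->; rewrite mul0r.
by rewrite !eqxx mulr1 mul1r !addr0 => /eqP; rewrite addr_eq0 => /eqP.
Qed.

Definition conj_mx P M : 'M[C]_n := invmx P *m M *m P.

Definition conj_entry M (k l : 'I_n) : G -> C := fun P => conj_mx P M k l.

Lemma conj_mx1 M : conj_mx 1%g M = M.
Proof. by rewrite /conj_mx /= invmx1 mul1mx mulmx1. Qed.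

Lemma conj_mxM P Q M : conj_mx (P * Q)%g M = conj_mx Q (conj_mx P M).
Proof.
rewrite /conj_mx /=.
have -> : invmx ((P : 'M[C]_n) *m Q) = invmx Q *m invmx P.
  exact: (congr1 (@Defs.GLval R n) (invgM P Q)).
by rewrite !mulmxA.
Qed.

(** Coproduct on these functions: the class of entries of conjugates is stable
    under translation, which only changes the conjugated matrix. *)
Lemma conj_entry_mul M (k l : 'I_n) P Q :
  conj_entry M k l (P * Q)%g = conj_entry (conj_mx P M) k l Q.
Proof. by rewrite /conj_entry conj_mxM. Qed.

Lemma conj_entryE M (k l : 'I_n) : conj_entry M k l =
  fun P => \sum_s \sum_r M r s * (antipode (g k r) * g s l) P.
Proof.
apply/funext => P; rewrite /conj_entry /conj_mx mxE; apply: eq_bigr => s _.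
rewrite mxE mulr_suml; apply: eq_bigr => r _.
by rewrite [in LHS](mulrC (invmx _ _ _)) -mulrA.
Qed.

Lemma Fn_conj_entry M (k l : 'I_n) : Fn (conj_entry M k l).
Proof.
rewrite conj_entryE; apply: Fn_sum => s; apply: Fn_sum => r; apply: Fn_scale.
by apply: Fn_mul; [exact: Fn_antipode_g|exact: Fn_g].
Qed.

(** The adjoint action: the derivative of (1 + t X)^-1 M (1 + t X) at t = 0 is
    the commutator of M and X. *)
Lemma pairing_conj_entry X M (k l : 'I_n) :
  pairing X (conj_entry M k l) = (M *m X - X *m M) k l.
Proof.
have Fe r s : Fn (antipode (@g R n k r) * g s l).
  by apply: Fn_mul; [exact: Fn_antipode_g|exact: Fn_g].
rewrite conj_entryE pairing_sum; last first.
  by move=> s; apply: Fn_sum => r; exact: Fn_scale.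
under eq_bigr => s _.
  rewrite pairing_sum; last by move=> r; exact: Fn_scale.
  under eq_bigr => r _.
    rewrite pairing_scale // pairingM ?counit_g ?counit_antipode_g ?pairing_g
      ?pairing_antipode_g; [|exact: Fn_antipode_g|exact: Fn_g].
    rewrite mulrDr addrC mulNr mulrN.
    over.
  rewrite big_split /= (bigD1 k) //= big1 => [|r]; last first.
    by rewrite eq_sym => /negPf ->; rewrite mul0r mulr0.
  rewrite eqxx mul1r addr0 sumrN.
  over.
rewrite big_split /= sumrN !mxE; congr (_ - _).
rewrite (bigD1 l) //= [X in _ + X]big1 => [|s /negPf ->]; last first.
  by rewrite big1 // => r _; rewrite mulr0 mulr0.
by rewrite addr0; apply: eq_bigr => r _; rewrite eqxx mulr1 mulrC.
Qed.

(** The (k, l) entry is a weight vector of weight e_l - e_k, an eigenvector of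
    every H_a. *)
Lemma Hdiag_conj_entry (a : 'I_n) M (k l : 'I_n) :
  Hdiag a (conj_entry M k l) = ((l == a)%:R - (k == a)%:R) * M k l.
Proof.
rewrite /Hdiag pairing_conj_entry !mxE mulrBl; congr (_ - _).
  rewrite (bigD1 a) //= big1 => [|r /negPf ra]; last by rewrite mxE ra mulr0.
  rewrite mxE eqxx addr0 /=; case: eqP => [->|]; first by rewrite mulr1 mul1r.
  by rewrite mulr0 mul0r.
rewrite (bigD1 a) //= big1 => [|r /negPf ra]; last by rewrite mxE ra andbF mul0r.
rewrite mxE eqxx andbT addr0; case: eqP => [->//|_]; by rewrite !mul0r.
Qed.

End FunctionsOnGL.

(** * The twist acting on entries of conjugates *)

Section Twist.
Variables (R : realType) (n : nat).
Local Notation C := (Cplx R).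
Local Notation G := (GL R n).
Local Notation I2 := ('I_n * 'I_n)%type.
Implicit Types (M N : 'M[C]_n) (P Q : G) (s t : I2) (w : I2 -> I2 -> C).

(** The bilinear form theta evaluated at the weights e_(s.2) - e_(s.1) and
    e_(t.2) - e_(t.1) of the matrix entries at positions s and t. *)
Definition weight_form (theta : 'M[C]_n) (s t : I2) : C :=
  theta s.1 t.1 - theta s.1 t.2 - theta s.2 t.1 + theta s.2 t.2.

(** Arbitrary coefficients are allowed because convolving with the exponent
    rescales each coefficient by its own eigenvalue: the family is stable, as
    the induction on convolution powers requires. *)
Definition conj_pair w M N : G -> G -> C := fun P P' =>
  \sum_s \sum_t w s t * (conj_entry M s.1 s.2 P * conj_entry N t.1 t.2 P').

(** Covers both exponents of the twist: the scalar is -i/2 for F_theta and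
    i/2 for its inverse. *)
Definition exponent (c : C) (theta : 'M[C]_n) : functional2 R n := fun f =>
  c * \sum_(a < n) \sum_(b < n) theta a b * tens (Hdiag a) (Hdiag b) f.

Lemma tens_conj_pair (a b : 'I_n) w M N :
  tens (Hdiag a) (Hdiag b) (conj_pair w M N) =
  \sum_s \sum_t w s t * (((s.2 == a)%:R - (s.1 == a)%:R) *
    ((t.2 == b)%:R - (t.1 == b)%:R)) * (M s.1 s.2 * N t.1 t.2).
Proof.
rewrite /tens /conj_pair.
have -> : (fun P => Hdiag b (fun P' => \sum_s \sum_t
      w s t * (conj_entry M s.1 s.2 P * conj_entry N t.1 t.2 P'))) =
    (fun P => \sum_s (\sum_t w s t * Hdiag b (conj_entry N t.1 t.2)) *
       conj_entry M s.1 s.2 P).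
  apply/funext => P; rewrite /Hdiag.
  under eq_fun do under eq_bigr do under eq_bigr do rewrite mulrA.
  rewrite pairing_sum => [|s]; last first.
    by apply: Fn_sum => t; exact/Fn_scale/Fn_conj_entry.
  apply: eq_bigr => s _; rewrite pairing_sum => [|t]; last first.
    exact/Fn_scale/Fn_conj_entry.
  rewrite mulr_suml; apply: eq_bigr => t _.
  by rewrite pairing_scale; [rewrite mulrAC|exact: Fn_conj_entry].
rewrite {1}/Hdiag pairing_sum => [|s]; last exact/Fn_scale/Fn_conj_entry.
apply: eq_bigr => s _; rewrite pairing_scale; last exact: Fn_conj_entry.
rewrite mulr_suml; apply: eq_bigr => t _.
rewrite -/(Hdiag a _) !Hdiag_conj_entry; ring.
Qed.

Lemma sum_weight_form (theta : 'M[C]_n) s t :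
  \sum_(a < n) \sum_(b < n) theta a b * (((s.2 == a)%:R - (s.1 == a)%:R) *
    ((t.2 == b)%:R - (t.1 == b)%:R)) = weight_form theta s t.
Proof.
have pick (f : 'I_n -> C) k : \sum_a f a * (k == a)%:R = f k.
  rewrite (bigD1 k) //= big1 ?eqxx ?mulr1 ?addr0 // => a.
  by rewrite eq_sym => /negPf ->; rewrite mulr0.
have diff (f : 'I_n -> C) k l :
    \sum_a f a * ((l == a)%:R - (k == a)%:R) = f l - f k.
  by under eq_bigr do rewrite mulrBr; rewrite sumrB !pick.
under eq_bigr => a _.
  under eq_bigr => b _ do rewrite mulrCA mulrC.
  rewrite -mulr_suml diff; over.
rewrite diff /weight_form; ring.
Qed.

Lemma exponent_conj_pair (c : C) (theta : 'M[C]_n) w M N :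
  exponent c theta (conj_pair w M N) =
  \sum_s \sum_t (c * weight_form theta s t) * w s t *
    (M s.1 s.2 * N t.1 t.2).
Proof.
rewrite /exponent.
under eq_bigr => a _ do under eq_bigr => b _ do
  rewrite tens_conj_pair mulr_sumr.
under eq_bigr => a _ do rewrite exchange_big.
rewrite exchange_big mulr_sumr; apply: eq_bigr => s _ /=.
under eq_bigr => a _ do under eq_bigr => b _ do rewrite mulr_sumr.
under eq_bigr => a _ do rewrite exchange_big.
rewrite exchange_big mulr_sumr; apply: eq_bigr => t _ /=.
rewrite -sum_weight_form -!mulrA; congr (_ * _).
rewrite mulr_suml; apply: eq_bigr => a _; rewrite mulr_suml.
apply: eq_bigr => b _; ring.
Qed.

Lemma conj_pair_mul w M N P P' :
  (fun Q Q' => conj_pair w M N (P * Q)%g (P' * Q')%g) =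
  conj_pair w (conj_mx P M) (conj_mx P' N).
Proof.
apply/funext => Q; apply/funext => Q'; rewrite /conj_pair.
by apply: eq_bigr => s _; apply: eq_bigr => t _; rewrite !conj_entry_mul.
Qed.

Lemma iter_exponent_conj_pair (c : C) (theta : 'M[C]_n) (m : nat) w M N :
  iter m (conv2 (exponent c theta)) (@counit2 R n) (conj_pair w M N) =
  \sum_s \sum_t (c * weight_form theta s t) ^+ m * w s t *
    (M s.1 s.2 * N t.1 t.2).
Proof.
elim: m w M N => [|m ih] w M N.
  rewrite /= /counit2 /conj_pair; apply: eq_bigr => s _; apply: eq_bigr => t _.
  by rewrite /conj_entry !conj_mx1 expr0 mul1r.
rewrite iterS {1}/conv2.
under eq_fun => P do under eq_fun => P' do rewrite conj_pair_mul ih.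
rewrite -/(conj_pair (fun s t => (c * weight_form theta s t) ^+ m * w s t) M N).
rewrite exponent_conj_pair; apply: eq_bigr => s _; apply: eq_bigr => t _.
by rewrite exprS !mulrA.
Qed.

(** If all the matrix entries that really occur share one eigenvalue z, the
    exponential of functionals reduces to the scalar exponential of z. *)
Lemma exp2_conj_pair (c z : C) (theta : 'M[C]_n) w M N :
  (forall s t, w s t * (M s.1 s.2 * N t.1 t.2) != 0 ->
     c * weight_form theta s t = z) ->
  exp2 (exponent c theta) (conj_pair w M N) =
  cexp z * conj_pair w M N 1%g 1%g.
Proof.
move=> eig; have term m :
    iter m (conv2 (exponent c theta)) (@counit2 R n) (conj_pair w M N) =
    z ^+ m * conj_pair w M N 1%g 1%g.
  rewrite iter_exponent_conj_pair mulr_sumr; apply: eq_bigr => s _.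
  rewrite mulr_sumr; apply: eq_bigr => t _; rewrite /conj_entry !conj_mx1.
  rewrite -mulrA.
  have [->|/eig ->//] := eqVneq (w s t * (M s.1 s.2 * N t.1 t.2)) 0.
  by rewrite !mulr0.
rewrite /exp2; apply: (cvg_lim (@norm_hausdorff _ C)).
have -> : series (fun m => iter m (conv2 (exponent c theta)) (@counit2 R n)
    (conj_pair w M N) / m`!%:R) =
    (fun m => series (exp_term z) m * conj_pair w M N 1%g 1%g).
  apply/funext => m; rewrite /series /= mulr_suml; apply: eq_bigr => k _.
  by rewrite term /exp_term mulrAC.
apply: cvgM; [exact: cvg_exp_series|exact: cvg_cst].
Qed.

Lemma F_thetaE (theta : 'M[C]_n) :
  F_theta theta = exp2 (exponent (- ('i / 2)) theta).
Proof. by []. Qed.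

Lemma F_theta_invE (theta : 'M[C]_n) :
  F_theta_inv theta = exp2 (exponent ('i / 2) theta).
Proof.
rewrite /F_theta_inv; congr exp2; apply/funext => f.
by rewrite /twist_exponent /exponent mulNr opprK.
Qed.

(** Right multiplication by the torus: a single pair of entries, hence a single
    eigenvalue. *)
Lemma F_theta_inv_conj_entry (theta : 'M[C]_n) s t M N :
  F_theta_inv theta (fun S S' =>
    conj_entry M s.1 s.2 S * conj_entry N t.1 t.2 S') =
  cexp ('i / 2 * weight_form theta s t) * (M s.1 s.2 * N t.1 t.2).
Proof.
(* The coefficients that single out the positions s and t. *)
pose w s' t' : C := ((s' == s) && (t' == t))%:R.
have wE (f : I2 -> I2 -> C) : \sum_s' \sum_t' w s' t' * f s' t' = f s t.
  rewrite (bigD1 s) //= [X in _ + X]big1 => [|s' /negPf s's]; last first.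
    by rewrite big1 // => t' _; rewrite /w s's mul0r.
  rewrite addr0 (bigD1 t) //= big1 => [|t' /negPf t't]; last first.
    by rewrite /w t't andbF mul0r.
  by rewrite /w !eqxx mul1r addr0.
have fE : (fun S S' => conj_entry M s.1 s.2 S * conj_entry N t.1 t.2 S') =
    conj_pair w M N.
  apply/funext => S; apply/funext => S'; apply/esym.
  exact: (wE (fun s' t' =>
    conj_entry M s'.1 s'.2 S * conj_entry N t'.1 t'.2 S')).
rewrite fE F_theta_invE (@exp2_conj_pair _ ('i / 2 * weight_form theta s t)).
  by rewrite -fE /conj_entry !conj_mx1.
move=> s' t'; rewrite /w.
have [->|_] := eqVneq s' s; last by rewrite mul0r eqxx.
by have [->|_] := eqVneq t' t; last by rewrite mul0r eqxx.
Qed.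

(** Left multiplication by the torus: only diagonal entries of M and N occur,
    and these have weight 0, so every term of the exponential but the constant
    one vanishes. *)
Lemma F_theta_conj_diag (theta : 'M[C]_n) w M N :
  is_diag_mx M -> is_diag_mx N ->
  F_theta theta (conj_pair w M N) = conj_pair w M N 1%g 1%g.
Proof.
move=> /is_diag_mxP dM /is_diag_mxP dN.
rewrite F_thetaE (@exp2_conj_pair _ 0) ?cexp0 ?mul1r // => s t.
have [s12|/dM ->] := eqVneq s.1 s.2; last by rewrite mul0r mulr0 eqxx.
rewrite /weight_form s12 => _; ring.
Qed.

(** Slicing in the third tensor factors gives the scalar; what is left is
    the product of the entries of (P Q)^-1 M (P Q) and (P' Q)^-1 N (P' Q), for
    which Q^-1 and Q supply the coefficients of entries in P and P'. *)
Lemma times_theta_conj_diag (theta : 'M[C]_n) s t M N :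
  is_diag_mx M -> is_diag_mx N ->
  times_theta theta (conj_entry M s.1 s.2) (conj_entry N t.1 t.2) =
  fun Q => cexp ('i / 2 * weight_form theta s t) *
    (conj_entry M s.1 s.2 Q * conj_entry N t.1 t.2 Q).
Proof.
move=> dM dN; apply/funext => Q; rewrite /times_theta.
have inner P P' : F_theta_inv theta (fun S S' =>
      conj_entry M s.1 s.2 (P * Q * S)%g * conj_entry N t.1 t.2 (P' * Q * S')%g) =
    cexp ('i / 2 * weight_form theta s t) *
      (conj_mx (P * Q)%g M s.1 s.2 * conj_mx (P' * Q)%g N t.1 t.2).
  rewrite -F_theta_inv_conj_entry; congr (F_theta_inv _ _).
  apply/funext => S; apply/funext => S'.
  by rewrite (conj_entry_mul M) (conj_entry_mul N).
under eq_fun => P do under eq_fun => P' do rewrite inner.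
pose z := cexp ('i / 2 * weight_form theta s t).
pose w s' t' : C := z * (invmx Q s.1 s'.1 * (Q : 'M[C]_n) s'.2 s.2) *
  (invmx Q t.1 t'.1 * (Q : 'M[C]_n) t'.2 t.2).
have expand K (k l : 'I_n) : conj_mx Q K k l =
    \sum_s' (invmx Q k s'.1 * (Q : 'M[C]_n) s'.2 l) * K s'.1 s'.2.
  rewrite -(pair_bigA _ (fun i j => (invmx Q k i * (Q : 'M[C]_n) j l) * K i j)).
  rewrite /= exchange_big /conj_mx mxE; apply: eq_bigr => j _.
  rewrite mxE mulr_suml; apply: eq_bigr => i _; ring.
have wE P P' : z * (conj_mx (P * Q)%g M s.1 s.2 * conj_mx (P' * Q)%g N t.1 t.2) =
    conj_pair w M N P P'.
  transitivity (z *
      ((\sum_s' (invmx Q s.1 s'.1 * (Q : 'M[C]_n) s'.2 s.2) *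
          conj_mx P M s'.1 s'.2) *
       (\sum_t' (invmx Q t.1 t'.1 * (Q : 'M[C]_n) t'.2 t.2) *
          conj_mx P' N t'.1 t'.2))).
    by congr (_ * (_ * _)); rewrite conj_mxM; exact: expand.
  rewrite mulr_suml mulr_sumr /conj_pair.
  apply: eq_bigr => s' _; rewrite !mulr_sumr; apply: eq_bigr => t' _.
  rewrite /w /conj_entry; ring.
have -> : (fun P P' => z * (conj_mx (P * Q)%g M s.1 s.2 *
    conj_mx (P' * Q)%g N t.1 t.2)) = conj_pair w M N.
  by apply/funext => P; apply/funext => P'; exact: wE.
by rewrite F_theta_conj_diag // -wE !mul1g.
Qed.

Lemma skew_mxE (theta : 'M[C]_n) :
  theta^T = - theta -> forall a b, theta a b = - theta b a.
Proof. by move=> /matrixP skew a b; have := skew b a; rewrite !mxE. Qed.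

Lemma K_thetaE (theta : 'M[C]_n) (i j i' j' : 'I_n) : theta^T = - theta ->
  K_theta theta i j i' j' = cexp ('i / 2 * weight_form theta (i, j) (i', j')).
Proof.
move=> /skew_mxE sk.
rewrite /K_theta /q_theta -!cexpD /weight_form /= (sk j' i) (sk i' j).
congr cexp; ring.
Qed.

Lemma weight_form_skew (theta : 'M[C]_n) s t : theta^T = - theta ->
  weight_form theta t s = - weight_form theta s t.
Proof.
move=> /skew_mxE sk.
rewrite /weight_form (sk t.1 s.1) (sk t.1 s.2) (sk t.2 s.1) (sk t.2 s.2); ring.
Qed.

(** The scalar of the exchanged product is the inverse of K, and the pointwise
    product is commutative. *)
Lemma times_theta_conj_diagC (theta : 'M[C]_n) (i j i' j' : 'I_n) M N :
  theta^T = - theta -> is_diag_mx M -> is_diag_mx N ->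
  times_theta theta (conj_entry M i j) (conj_entry N i' j') =
  K_theta theta i j i' j' ^+ 2 *:
    times_theta theta (conj_entry N i' j') (conj_entry M i j).
Proof.
move=> skew dM dN; rewrite K_thetaE //.
rewrite (@times_theta_conj_diag _ (i, j) (i', j')) //.
rewrite (@times_theta_conj_diag _ (i', j') (i, j)) //.
apply/funext => Q /=.
set z := 'i / 2 * weight_form theta (i, j) (i', j').
transitivity (cexp z ^+ 2 * (cexp (- z) *
  (conj_entry N i' j' Q * conj_entry M i j Q))).
  rewrite expr2 -mulrA (mulrA (cexp z) (cexp (- z))) -cexpD subrr cexp0 mul1r.
  by rewrite [X in _ * X]mulrC.
by rewrite /z -mulrN -weight_form_skew.
Qed.

End Twist.

(** * Coinvariants of the Levi subgroup *)

Section Coinvariants.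
Variables (R : realType) (n d : nat).
Local Notation C := (Cplx R).

Definition block_proj (p : pred 'I_n) : 'M[C]_n := diag_mx (\row_k (p k)%:R).

Lemma sum_antipode_gE (p : pred 'I_n) (i j : 'I_n) :
  \sum_(k < n | p k) antipode (@g R n i k) * g k j =
  conj_entry (block_proj p) i j.
Proof.
apply/funext => P; rewrite fct_sumE /conj_entry /conj_mx mxE.
rewrite [RHS](bigID p) /= [X in _ + X]big1 => [|k /negPf pk].
  rewrite addr0; apply: eq_bigr => k pk.
  by rewrite mul_mx_diag !mxE pk mulr1.
by rewrite mul_mx_diag !mxE pk mulr0 mul0r.
Qed.

Lemma Levi_comm_block_proj (p : pred 'I_n) (h : Levi R n d) :
  (forall i j, same_block d i j -> p i = p j) ->
  conj_mx h (block_proj p) = block_proj p.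
Proof.
move=> pd; rewrite /conj_mx -mulmxA.
suff -> : block_proj p *m (h : GL R n) = (h : GL R n) *m block_proj p.
  by rewrite mulKmx // GLvalP.
rewrite mul_diag_mx mul_mx_diag; apply/matrixP => i j; rewrite !mxE.
have [/pd ->|/LeviP ->] := boolP (same_block d i j); first exact: mulrC.
by rewrite mulr0 mul0r.
Qed.

Lemma coinvariant_conj_block_proj (p : pred 'I_n) (i j : 'I_n) :
  (forall k l, same_block d k l -> p k = p l) ->
  coinvariant d (conj_entry (block_proj p) i j).
Proof.
move=> pd; split=> [|h P]; first exact: Fn_conj_entry.
rewrite /Levi_coaction /Levi_proj /coproduct conj_entry_mul.
by rewrite Levi_comm_block_proj.
Qed.

End Coinvariants.

(** * The commutation relations *)

Theorem theorem6p21 (R : realType) (n d : nat) (d_gt0 : (1 <= d)%N)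
    (d_ltn : (d < n)%N) (theta : 'M[Cplx R]_n)
    (theta_skew : theta^T = - theta)
    (theta_block : forall i j : 'I_n, ~~ same_block d i j -> theta i j = 0) :
  (forall i j : 'I_n,
     coinvariant d (@eta R n d i j) /\ coinvariant d (@eta_perp R n d i j)) /\
  (forall i j i' j' : 'I_n,
   [/\ times_theta theta (eta d i j) (eta d i' j') =
         K_theta theta i j i' j' ^+ 2 *: times_theta theta (eta d i' j') (eta d i j),
       times_theta theta (eta_perp d i j) (eta_perp d i' j') =
         K_theta theta i j i' j' ^+ 2 *:
           times_theta theta (eta_perp d i' j') (eta_perp d i j)
     & times_theta theta (eta d i j) (eta_perp d i' j') =
         K_theta theta i j i' j' ^+ 2 *:
           times_theta theta (eta_perp d i' j') (eta d i j)]).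
Proof.
have etaE (i j : 'I_n) : eta d i j = conj_entry (block_proj R (fun k => (k < d)%N)) i j.
  exact: sum_antipode_gE.
have etapE (i j : 'I_n) :
    eta_perp d i j = conj_entry (block_proj R (fun k => (d <= k)%N)) i j.
  exact: sum_antipode_gE.
have diag (p : pred 'I_n) : is_diag_mx (block_proj R p) := diag_mx_is_diag _.
split=> [i j|i j i' j'].
  split; [rewrite etaE|rewrite etapE]; apply: coinvariant_conj_block_proj => k l.
    by move=> /eqP.
  by rewrite (leqNgt d k) (leqNgt d l) => /eqP ->.
rewrite (etaE i j) (etaE i' j') (etapE i j) (etapE i' j').
by split; exact: times_theta_conj_diagC.
Qed.
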